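(* Let $G$ be a finite solvable group. Then $\gamma_{\text{cp}}(G)\leq 4\log_{2}|G|$.
   Context: All groups are finite. For subsets $A_1,\dots,A_k$ of a group $G$, $A_1\cdots A_k=\{a_1\cdots a_k : a_i\in A_i\}$ is the setwise product. For a finite group $G$, $\gamma_{\text{cp}}(G)$ is defined as follows: if $G$ is non-nilpotent, $\gamma_{\text{cp}}(G)$ is the minimal integer $k$ such that $G$ is a product of $k$ conjugates of a proper subgroup of $G$, that is, such that there exist proper subgroups $A_1,\dots,A_k$ of $G$, any two of which are conjugate in $G$ (repetitions allowed), with $G=A_1\cdots A_k$ (such a $k$ exists for every non-nilpotent $G$); if $G$ is nilpotent, $\gamma_{\text{cp}}(G)=\infty$, with the conventions $n<\infty$ for any natural number $n$ and $\infty\leq\infty$.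
   Formalization: The group G is additionally assumed non-nilpotent: for nilpotent G (for instance the group of order 2) the convention sets γ_cp(G) = ∞, so the stated inequality with the finite bound 4 log₂|G| is false. *)

(* Defs.v *)
(* MathComp (finite groups), with MathComp-Analysis for the logarithm and
   the extended reals. *)
From HB Require Import structures.
From mathcomp Require Import all_boot all_order all_algebra.
From mathcomp Require Import all_fingroup all_solvable.
From mathcomp Require Import reals constructive_ereal exp.

Set Implicit Arguments.
Unset Strict Implicit.
Unset Printing Implicit Defensive.

Section ConjugateFactorizations.
Local Open Scope group_scope.
Variable gT : finGroupType.
Implicit Types (G M : {group gT}) (k : nat).

(* The big product is the setwise product of [{set gT}], in index order, not
   the join of groups. *)
Definition conj_factorization G k (A : {ffun 'I_k -> {group gT}}) : bool :=
  [&& [forall i, A i \proper G],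
      [forall i, forall j, (A j : {set gT}) \in A i :^: G]
    & \prod_(i < k) (A i : {set gT}) == G].

Definition prod_conj_subgroups G k : bool :=
  [exists A : {ffun 'I_k -> {group gT}}, conj_factorization G A].

Lemma nonnil_nonnormal_maximal G :
  ~ nilpotent G -> exists2 M : {group gT}, maximal M G & ~~ (M <| G).
Proof.
move=> nnG; have [p [P [sylP nPG]]] :
    exists p (P : {group gT}), p.-Sylow(G) P /\ ~~ (P <| G).
  case: (pickP [pred P : {group gT} | Sylow G P && ~~ (P <| G)]) => [P|noP].
    by case/andP=> /SylowP[p _ sylP] nP; exists p, P.
  case: nnG; rewrite -(_ : 'F(G) = G) ?Fitting_nil //.
  apply/eqP; rewrite eqEsubset Fitting_sub -{1}(Sylow_gen G) gen_subG.
  apply/bigcupsP=> P sylP; apply: Fitting_max; last first.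
    by case/SylowP: sylP => p _ /pHall_pgroup /pgroup_nil.
  by apply/idPn=> nP; have := noP P; rewrite /= sylP nP.
have sPG := pHall_sub sylP.
have [eqNG | [M maxM sNM]] := maximal_exists (subsetIl G 'N(P)).
  by case/negP: nPG; rewrite /normal sPG -{1}eqNG subsetIr.
exists M => //; apply/negP=> nMG.
have sPM : P \subset M by rewrite (subset_trans _ sNM) // subsetI sPG normG.
have sylPM : p.-Sylow(M) P by exact: pHall_subl sPM (normal_sub nMG) sylP.
have /maxgroupp/andP[_ /negP[]] := maxM.
by rewrite -{1}(Frattini_arg nMG sylPM) mul_subG.
Qed.

Lemma nonnil_prod_conj_subgroups G :
  ~ nilpotent G -> exists k, prod_conj_subgroups G k.
Proof.
move=> nnG; have [M maxM nMG] := nonnil_nonnormal_maximal nnG.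
have [sMG prMG] : M \subset G /\ M \proper G.
  by move/maxgroupp: maxM => prMG; rewrite (proper_sub prMG).
pose cls := [seq (M :^ x)%G | x <- enum G].
pose B := \prod_(H <- cls) (H : {set gT}).
have sub_prod (s : seq {group gT}) (H : {group gT}) :
    H \in s -> H \subset \prod_(K <- s) (K : {set gT}).
  elim: s => // K s IHs; rewrite inE big_cons => /predU1P[-> | /IHs sHs].
    apply: mulg_subl; elim: (s) => [|L t IHt]; first by rewrite big_nil set11.
    by rewrite big_cons -(mulg1 1) mem_mulg.
  by apply: subset_trans sHs _; apply: mulg_subr.
have sMxB x : x \in G -> M :^ x \subset B.
  by move=> Gx; apply: (sub_prod cls (M :^ x)%G); apply: map_f; rewrite mem_enum.
have sBG : B \subset G.
  rewrite /B big_map big_seq; elim/big_ind: _ => [|C D|x]; first exact: sub1G.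
    exact: mul_subG.
  by rewrite mem_enum => Gx; rewrite /= -(conjGid Gx) conjSg.
have genB : <<B>> = G.
  pose N := <<class_support M G>>%G.
  have sMN : M \subset N by rewrite sub_gen ?sub_class_support.
  have nNG : G \subset 'N(N) by rewrite norms_gen ?class_support_norm.
  have sNB : N \subset <<B>>.
    rewrite gen_subG class_supportEr; apply/bigcupsP=> x Gx.
    by rewrite sub_gen ?sMxB.
  have sNG : N \subset G by rewrite gen_subG class_support_subG.
  apply/eqP; rewrite eqEsubset gen_subG sBG; apply: subset_trans sNB.
  have [_ maxMG] := maxgroupP maxM; apply/idPn=> nGN.
  by case/negP: nMG; rewrite -(maxMG N) ?/normal ?sNG // properE sNG.
have [n] := gen_expgs B; rewrite genB (setUidPr _) => [defG|]; last first.
  by rewrite sub1set (subsetP (sMxB 1 _)) ?group1.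
pose s := flatten (nseq n cls).
have prod_s : \prod_(H <- s) (H : {set gT}) = G.
  rewrite defG /s; elim: (n) => [|m IHm]; first by rewrite big_nil.
  by rewrite /= big_cat /= IHm expgS.
have clsP H : H \in s -> exists2 x, x \in G & H = (M :^ x)%G.
  case/flattenP=> c /nseqP[-> _] /mapP[x]; rewrite mem_enum => Gx ->.
  by exists x.
exists (size s); apply/existsP; exists [ffun i => tnth (in_tuple s) i].
apply/and3P; split.
- apply/forallP=> i; rewrite ffunE.
  have [x Gx ->] := clsP _ (mem_tnth i (in_tuple s)).
  by have := properJ M G x; rewrite (conjGid Gx) prMG => ->.
- apply/forallP=> i; apply/forallP=> j; rewrite !ffunE.
  have [x Gx ->] := clsP _ (mem_tnth i (in_tuple s)).
  have [y Gy ->] := clsP _ (mem_tnth j (in_tuple s)).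
  by apply/imsetP; exists (x^-1 * y); rewrite ?groupM ?groupV //= -conjsgM mulKVg.
- apply/eqP; rewrite -[RHS]prod_s (big_tnth _ _ s).
  by apply: eq_bigr => i _; rewrite ffunE.
Qed.

Definition min_prod_conj G (nnG : ~ nilpotent G) : nat :=
  ex_minn (nonnil_prod_conj_subgroups nnG).

End ConjugateFactorizations.

Import GRing.Theory.
Local Open Scope ring_scope.

Definition gamma_cp (R : realType) (gT : finGroupType) (G : {group gT}) : \bar R :=
  match @idP (nilpotent G) with
  | ReflectT _ => +oo%E
  | ReflectF nnG => ((min_prod_conj nnG)%:R)%:E
  end.

Definition log2 (R : realType) (x : R) : R := ln x / ln 2.

(* Main.v *)
Require Import Defs.
From mathcomp Require Import all_boot all_order all_algebra.
From mathcomp Require Import all_fingroup all_solvable.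
From mathcomp Require Import reals constructive_ereal exp.

Set Implicit Arguments.
Unset Strict Implicit.
Unset Printing Implicit Defensive.

(** Let M be a non-normal maximal subgroup of G. Modulo the core of M, we may
write G = M V with V an abelian minimal normal subgroup, and then [V, M] = V.
For v in V, m in M and w = v^m v^-1, both 1 and w lie in the product of two
conjugates M M^(v^-1), and the same holds for every power w^c = (v^c)^m v^-c.
Using c = 1, 2, 4, ..., 2^(e-1), a product of 2e conjugates of M contains
w^i for all i < 2^e. If W is a subgroup of V of index q in W<w>, one takes for
e the least integer with q <= 2^e; as 2^e <= q^2, climbing from W = 1 to
W = V takes at most 4 log2 |V| conjugates. One further factor M yields
G = M V, and it is paid for by |G| >= 2 |V|. *)

(** * Covering an abelian group by conjugates of a group acting on it *)

Section ConjugateProducts.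
Local Open Scope group_scope.
Variable gT : finGroupType.
Implicit Types (G M K V W : {group gT}) (s : seq gT).

(** Lists of conjugating elements concatenate easily, unlike families indexed by ['I_k]. Covering
    [G] suffices, as all conjugates lie in [G]. *)
Lemma prod_conj_seq G M s :
    M \proper G -> {subset s <= G} -> G \subset \prod_(x <- s) M :^ x ->
  prod_conj_subgroups G (size s).
Proof.
move=> prMG sG sGP.
have defG : \prod_(x <- s) M :^ x = G.
  apply/eqP; rewrite eqEsubset sGP andbT big_seq.
  elim/big_ind: _ => [|A B|x /sG Gx]; [exact: sub1G | exact: mul_subG |].
  by rewrite -(conjGid Gx) conjSg proper_sub.
apply/existsP; exists [ffun i => (M :^ tnth (in_tuple s) i)%G].
have tG i : tnth (in_tuple s) i \in G by apply/sG/mem_tnth.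
apply/and3P; split.
- apply/forallP=> i; rewrite ffunE /=.
  have := properJ M G (tnth (in_tuple s) i).
  by rewrite (conjGid (tG i)) prMG => ->.
- apply/forallP=> i; apply/forallP=> j; rewrite !ffunE /=.
  apply/imsetP; exists ((tnth (in_tuple s) i)^-1 * tnth (in_tuple s) j).
    by rewrite groupM ?groupV.
  by rewrite -conjsgM mulKVg.
- apply/eqP; rewrite -[RHS]defG (big_tnth _ _ s).
  by apply: eq_bigr => i _; rewrite ffunE.
Qed.

(** Lifted conjugators cover [G] up to a left factor [K], which the first conjugate absorbs because
    it contains [K]. *)
Lemma quotient_prod_conj_seq G M K (t : seq (coset_of K)) :
    K <| G -> K \subset M -> M \proper G ->
    {subset t <= G / K} -> G / K \subset \prod_(x <- t) (M / K) :^ x ->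
  exists s, [/\ size s = size t, {subset s <= G}
              & G \subset \prod_(x <- s) M :^ x].
Proof.
move=> nKG sKM prMG tG sGt; have nKGs := normal_norm nKG.
have sMG := proper_sub prMG.
have [s [<- sG ds]] : exists s, [/\ size s = size t, {subset s <= G}
    & (\prod_(x <- s) M :^ x) / K = \prod_(x <- t) (M / K) :^ x].
  elim: t tG {sGt} => [|x t IHt] tG.
    by exists [::]; rewrite !big_nil /quotient morphim1.
  have [|s [ss sG ds]] := IHt; first by move=> y ty; rewrite tG // inE ty orbT.
  have /morphimP[y Ny Gy def_x] := tG x (mem_head x t).
  exists (y :: s); split=> [|z|]; first by rewrite /= ss.
    by rewrite inE => /predU1P[-> | /sG].
  rewrite !big_cons quotientMl ?ds ?quotientJ ?def_x //.
  by apply: subset_trans nKGs; rewrite -(conjGid Gy) conjSg.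
exists s; split=> //; move: sGt; rewrite -ds quotientSK //.
case: s sG {ds} => [_ | x s sG].
  rewrite big_nil mulg1 => sGK; case/andP: prMG => _ /negP[].
  exact: subset_trans sGK sKM.
rewrite big_cons mulgA mulSGid //.
have Gx : x \in G by rewrite sG ?mem_head.
by rewrite -(normP (subsetP nKGs x Gx)) conjSg.
Qed.

(** Induction on the number of binary digits of [i]: the two conjugates added at each step supply
    the new top digit, as their product contains both 1 and [w ^+ (2 ^ e)], where
    [w = v ^ m * v^-1]. *)
Lemma powers_sub_prod_conj V M v m e :
    abelian V -> M \subset 'N(V) -> v \in V -> m \in M ->
  exists s, [/\ size s = (2 * e)%N, {subset s <= V}
    & forall i, (i < 2 ^ e)%N ->
        (v ^ m * v^-1) ^+ i \in \prod_(x <- s) M :^ x].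
Proof.
move=> abV nVM Vv Mm; elim: e => [|e [s [ss sV IHe]]].
  by exists [::]; split=> // [] [|i] // _; rewrite big_nil expg0 inE.
pose u := v ^+ (2 ^ e).
have Vu : u \in V by rewrite groupX.
exists (s ++ [:: 1; u^-1]); split=> [|x|i lti].
- by rewrite size_cat ss /= mulnS addnC.
- rewrite mem_cat !inE => /orP[/sV // | /orP[]] /eqP->; first exact: group1.
  by rewrite groupV.
rewrite big_cat !big_cons big_nil conjsg1 /=. rewrite mulg1.
have Muu : 1 \in M * M :^ u^-1 by rewrite -(mulg1 1) mem_mulg ?group1.
have [ltie | leei] := ltnP i (2 ^ e).
  by rewrite -[_ ^+ i]mulg1 mem_mulg ?IHe.
rewrite -(subnK leei) expgD mem_mulg ?IHe //.
  by rewrite ltn_subLR // addnn -mul2n -expnS.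
have Vvm : v ^ m \in V by rewrite memJ_norm ?(subsetP nVM).
rewrite expgMn; last by apply: (centsP abV); rewrite ?groupV.
rewrite -conjXg expgVn -/u (_ : u ^ m * u^-1 = m^-1 * (m ^ u^-1)).
  by rewrite mem_mulg ?groupV ?memJ_conjg.
by rewrite !conjgE invgK !mulgA.
Qed.

(** Modulo [W] the join is cyclic, generated by the image of [w], whose order is the index. *)
Lemma cycle_join_powers W w x :
    w \in 'N(W) -> x \in W <*> <[w]> ->
  exists2 i, (i < #|W <*> <[w]> : W|)%N & x \in W :* w ^+ i.
Proof.
move=> nWw; have nWc : <[w]> \subset 'N(W) by rewrite cycle_subG.
have defU : (W <*> <[w]>) / W = <[coset W w]>.
  by rewrite quotientYidl // quotient_cycle.
have nWU : W <*> <[w]> \subset 'N(W) by rewrite join_subG normG.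
move=> Ux; have: coset W x \in <[coset W w]>.
  by rewrite -defU mem_quotient.
case/cyclePmin=> i; rewrite orderE -defU card_quotient // => lti def_x.
exists i => //.
apply/rcoset_kercosetP; [exact: (subsetP nWU) | exact: groupX |].
by rewrite def_x morphX.
Qed.

Lemma up_log_sqr q : (1 < q)%N -> (2 ^ up_log 2 q <= q ^ 2)%N.
Proof.
move=> q_gt1; have /andP[lt_q _] := up_log_bounds (isT : 1 < 2)%N q_gt1.
have e_gt0 : (0 < up_log 2 q)%N by rewrite up_log_gt0.
rewrite -(prednK e_gt0) expnS (@leq_trans (2 * q)) //.
  by rewrite leq_mul2l ltnW.
by rewrite expnS leq_mul2r q_gt1 orbT.
Qed.

(** The logarithmic bound is kept in exponential form, so that it is multiplicative along the
    climb. *)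
Lemma abelian_sub_prod_conj V M :
    abelian V -> M \subset 'N(V) -> [~: V, M] = V ->
  exists s, [/\ (2 ^ size s <= #|V| ^ 4)%N, {subset s <= V}
              & V \subset \prod_(x <- s) M :^ x].
Proof.
move=> abV nVM defV.
pose reach W := exists s, [/\ (2 ^ size s <= #|W| ^ 4)%N, {subset s <= V}
              & W \subset \prod_(x <- s) M :^ x].
(* Here [n] only drives the induction: [W] grows strictly until it equals [V]. *)
suffices climb n : exists W, [/\ W \subset V, reach W
                              & (n <= #|W|)%N || (W == V)].
  have [W [sWV rW]] := climb #|V|; case/orP=> [leVW | /eqP defW].
    have defW : W = V by apply/val_inj/eqP; rewrite eqEcard sWV.
    by rewrite defW in rW.
  by rewrite defW in rW.
elim: n => [|n [W [sWV rW]]].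
  exists 1%G; split; rewrite ?sub1G //; exists [::].
  by rewrite big_nil cards1.
have [eqWV _ | neWV] := eqVneq W V.
  by exists W; split; rewrite // eqWV eqxx orbT.
rewrite orbF => lenW; have [s [les sV sWP]] := rW.
(* Otherwise all generators of [[~: V, M] = V] would lie in [W]. *)
have [v [m [Vv Mm nWw]]] :
    exists v, exists m, [/\ v \in V, m \in M & v ^ m * v^-1 \notin W].
  case: (pickP [pred u : gT * gT | [&& u.1 \in V, u.2 \in M
                               & u.1 ^ u.2 * u.1^-1 \notin W]]) => [[v m]|noW].
    by case/and3P; exists v, m.
  case/negP: neWV; rewrite -val_eqE /= eqEsubset sWV -defV gen_subG.
  apply/subsetP=> _ /imset2P[v m Vv Mm ->]; apply/idPn=> nWw.
  case/idP: (noW (v, m)); rewrite /= Vv Mm.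
  have Vvm : v ^ m \in V by rewrite memJ_norm ?(subsetP nVM).
  by rewrite (centsP abV _ Vvm) ?groupV // -commgEl.
set w := _ * _ in nWw.
have Vw : w \in V by rewrite groupM ?groupV ?memJ_norm ?(subsetP nVM).
have nWVs : V \subset 'N(W) by apply: sub_abelian_norm.
pose U := (W <*> <[w]>)%G; pose q := #|U : W|.
have sWU : W \subset U by apply: joing_subl.
have q_gt1 : (1 < q)%N.
  rewrite indexg_gt1; apply: contra nWw => /subsetP-> //.
  by rewrite mem_gen // inE cycle_id orbT.
have [t [st tV tP]] := powers_sub_prod_conj (up_log 2 q) abV nVM Vv Mm.
have cardU : #|U| = (#|W| * q)%N by rewrite Lagrange.
exists U; split; last 1 first.
- by rewrite cardU (leq_ltn_trans lenW) // -{1}[#|W|]muln1 ltn_pmul2l.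
- by rewrite join_subG sWV cycle_subG.
exists (s ++ t); split.
(* With [e = up_log 2 q], the new conjugates cost [2 ^ (2 * e) <= (q ^ 2) ^ 2]. *)
- rewrite size_cat expnD cardU expnMn leq_mul // st mulnC expnM.
  by rewrite (expnM q 2 2) leq_exp2r // up_log_sqr.
- by move=> x; rewrite mem_cat => /orP[/sV | /tV].
apply/subsetP=> x /cycle_join_powers[]; first exact: (subsetP nWVs).
move=> i ltiq /rcosetP[y Wy ->]; rewrite big_cat mem_mulg ?(subsetP sWP) //.
by apply: tP; apply: leq_trans ltiq _; apply: up_logP.
Qed.

End ConjugateProducts.

(** * Solvable groups: the core-free case and the reduction to it *)

Section SolvableGroups.
Local Open Scope group_scope.

Lemma corefree_prod_conj (gT : finGroupType) (G M : {group gT}) :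
    solvable G -> maximal M G -> ~~ (M <| G) -> gcore M G = 1 ->
  exists s, [/\ (2 ^ size s <= #|G| ^ 4)%N, {subset s <= G}
              & G \subset \prod_(x <- s) M :^ x].
Proof.
move=> solG maxM nnM coreM; have prMG := maxgroupp maxM.
have sMG := proper_sub prMG.
have ntG : G :!=: 1.
  by apply: contraTneq prMG => ->; rewrite properE sub1G andbF.
have [V minV sVG] := minnormal_exists ntG (normG G).
have [_ ntV abelV] := minnormal_solvable minV sVG solG.
have abV : abelian V by case/is_abelemP: abelV => p _ /abelem_abelian.
have [/andP[_ nVG] minVP] := mingroupP minV.
have nVM := subset_trans sMG nVG.
have nsVM : ~~ (V \subset M).
  by apply: contra ntV => sVM; rewrite -subG1 -coreM gcore_max.
have defG : M * V = G.
  have [_ maxMG] := maxgroupP maxM; apply/eqP; rewrite eqEsubset mul_subG //=.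
  apply/idPn=> nGMV; case/negP: nsVM; rewrite -(norm_joinEl nVM) in nGMV.
  rewrite -(maxMG (M <*> V)%G) ?joing_subl ?joing_subr //.
  by rewrite properE nGMV join_subG sMG sVG.
(* If [M] centralised [V], then [V] would normalise [M], making [M] normal in [M * V = G]. *)
have ntR : [~: V, M] != 1.
  apply: contra nnM => /eqP/commG1P; rewrite centsC => cMV.
  by rewrite /normal sMG -defG mul_subG ?normG // cents_norm // centsC.
(* Both [V] and [M] normalise the commutator, so it is normal in [G] and minimality of [V]
   applies. *)
have defV : [~: V, M] = V.
  apply: minVP; last by rewrite commg_subl.
  by rewrite ntR -defG mul_subG ?commg_normr ?commg_norml.
have [s [les sV sVP]] := abelian_sub_prod_conj abV nVM defV.
exists (1 :: s); split=> [|x|].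
- rewrite /= expnS -(Lagrange sVG) expnMn mulnC leq_mul //.
  (* If [V = G], then [M] would lie in the abelian group [V] and centralise it. *)
  have: (1 < #|G : V|)%N.
    rewrite indexg_gt1; apply: contra ntR => sGV; apply/eqP/commG1P.
    exact: sub_abelian_cent2 abV (subxx _) (subset_trans sMG sGV).
  by case: #|G : V| => [|[|q]] // _; rewrite (@leq_trans (2 ^ 4)) ?leq_exp2r.
- by rewrite inE => /predU1P[-> | /sV /(subsetP sVG)].
by rewrite big_cons conjsg1 -{1}defG mulgS.
Qed.

Lemma solvable_prod_conj (gT : finGroupType) (G : {group gT}) :
    solvable G -> ~ nilpotent G ->
  exists2 k, (2 ^ k <= #|G| ^ 4)%N & prod_conj_subgroups G k.
Proof.
move=> solG nnG; have [M maxM nnM] := nonnil_nonnormal_maximal nnG.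
have prMG := maxgroupp maxM; have sMG := proper_sub prMG.
pose K := gcore_group M G.
have sKM : K \subset M by apply: gcore_sub.
have nKG : K <| G by rewrite /normal gcore_norm (subset_trans sKM).
have nKM : K <| M by apply: normalS nKG.
(* The preimage of this core is normal in [G] and contained in [M], hence in [K]. *)
have coreMK : gcore (M / K) (G / K) = 1.
  have sMKG : M / K \subset G / K by apply: quotientS.
  have [H defH sKH nHG] := inv_quotientN nKG (gcore_normal sMKG).
  have nKH : H \subset 'N(K).
    exact: subset_trans (normal_sub nHG) (normal_norm nKG).
  have sHM : H \subset M by rewrite -(quotientSGK nKH sKM) -defH gcore_sub.
  rewrite defH; apply/trivgP; rewrite quotient_sub1 //.
  exact: gcore_max (normal_norm nHG).
have [||||t [le_t tG sGt]] := @corefree_prod_conj _ (G / K)%G (M / K)%G.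
- exact: quotient_sol.
- by rewrite quotient_maximal.
- apply: contra nnM => nMK.
  by rewrite -(quotientGK nKM) -(quotientGK nKG) cosetpre_normal.
- exact: coreMK.
have [s [ss sG sGP]] := quotient_prod_conj_seq nKG sKM prMG tG sGt.
exists (size s); last exact: prod_conj_seq prMG sG sGP.
by rewrite ss (leq_trans le_t) // leq_exp2r // leq_quotient.
Qed.
End SolvableGroups.

(** * From powers of two to logarithms *)

Import Order.TTheory GRing.Theory Num.Theory.
Local Open Scope ring_scope.

Lemma natr_le_log2 (R : realType) (c k n : nat) :
  (0 < n)%N -> (2 ^ k <= n ^ c)%N -> k%:R <= c%:R * log2 n%:R :> R.
Proof.
move=> n_gt0 le_kn; rewrite /log2 mulrA ler_pdivlMr ?ln_gt0 ?ltr1n //.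
rewrite ![_%:R * ln _]mulr_natl -!lnXn ?ltr0n // -!natrX.
by rewrite ler_ln ?posrE ?ltr0n ?expn_gt0 ?n_gt0 // ler_nat.
Qed.

Theorem theorem5 (R : realType) (gT : finGroupType) (G : {group gT}) :
  solvable G -> ~~ nilpotent G ->
  (gamma_cp R G <= (4 * log2 #|G|%:R)%:E)%E.
Proof.
move=> solG nnG; rewrite /gamma_cp.
destruct idP as [nG | nnG']; first by rewrite nG in nnG.
rewrite lee_fin natr_le_log2 ?cardG_gt0 // /min_prod_conj.
case: ex_minnP => m _ min_m.
have [k le_k /min_m le_mk] := solvable_prod_conj solG nnG'.
by apply: leq_trans le_k; rewrite leq_exp2l.
Qed.
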